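(* Let $n\ge 1$ and let $A_{\mathbb{F}_3^n}$ be the $3$-dimensional convolution matrix of the additive group $\mathbb{F}_3^n$. Then for all nonnegative integers $k_0,k_1,k_2$ with $k_0+k_1+k_2\le n$, the number $3^{k_0}(i\sqrt3)^{k_1}(-i\sqrt3)^{k_2}$ is an eigenvalue of $A_{\mathbb{F}_3^n}$.
   Context: For a finite abelian group $G$, the convolution matrix $A_G$ is the $3$-dimensional $(0,1)$-array $(a_{x,y,z})_{x,y,z\in G}$ with $a_{x,y,z}=1$ if $x=y+z$ and $a_{x,y,z}=0$ otherwise. For $f:G\to\mathbb{C}$, $(A_G\circ f)(x)=\sum_{y,z\in G}a_{x,y,z}f(y)f(z)$. A number $\theta\in\mathbb{C}$ is an eigenvalue of $A_G$ if there is a function $f:G\to\mathbb{C}$, $f\not\equiv 0$ (an eigenfunction), such that $(A_G\circ f)(x)=\theta f(x)^2$ for all $x\in G$. *)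

(* Defs.v *)
From mathcomp Require Import all_boot all_order all_algebra.
From mathcomp Require Import reals complex.

Set Implicit Arguments.
Unset Strict Implicit.
Unset Printing Implicit Defensive.

Import Order.TTheory GRing.Theory Num.Theory.
Local Open Scope ring_scope.

(* The complex numbers are R[i], with R any model of the real numbers. *)

Definition array3 (R : realType) (G : finType) := G -> G -> G -> R[i].

Definition array3_app (R : realType) (G : finType) (A : array3 R G)
    (f : G -> R[i]) (x : G) : R[i] :=
  \sum_(y : G) \sum_(z : G) A x y z * f y * f z.

Definition eigenvalue3 (R : realType) (G : finType) (A : array3 R G)
    (theta : R[i]) : Prop :=
  exists f : G -> R[i],
    (exists x, f x != 0) /\ forall x, array3_app A f x = theta * f x ^+ 2.

Definition conv_array (R : realType) (G : finZmodType) : array3 R G :=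
  fun x y z => if x == y + z then 1 else 0.

Arguments conv_array R G : clear implicits.

(* Main.v *)
Require Import Defs.
From mathcomp Require Import all_boot all_order all_algebra.
From mathcomp Require Import reals complex.
From mathcomp Require Import ring.

Import GRing.Theory Num.Theory.
Local Open Scope ring_scope.

(** Eigenvalues of convolution matrices multiply under direct products of
    groups: if [h_j] is an eigenfunction for [t_j] on [G], then the tensor
    product [x |-> \prod_j h_j (x_j)] is an eigenfunction for [\prod_j t_j] on
    [G ^ n], because the convolution sum over [G ^ n] factors coordinatewise
    ([eigenvalue3_prod]).  It therefore suffices to realise the four numbers
    [1], [3] and [+/- i sqrt 3] on the group [F_3] itself, the first one
    filling the [n - (k0 + k1 + k2)] unused coordinates.

    On [F_3], take the function with value [1] at [0] and [b] elsewhere.  Its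
    self-convolution is [1 + 2 b ^ 2] at [0] and [2 b + b ^ 2] elsewhere, so it
    is an eigenfunction for [1 + 2 b ^ 2] exactly when [b ^ 4 = b]
    ([eigenvalue3_F3]).  The solutions [b = 0], [b = 1] and the two primitive
    cube roots of unity give [1], [3] and the two square roots of [-3]; in the
    last case the function is [b ^ (x ^ 2)] and [1 + 2 b ^ 2] is the
    quadratic Gauss sum attached to the character [x |-> b ^ (2 x)]. *)

Lemma conv_array_app (R : realType) (G : finZmodType) (f : G -> R[i]) (x : G) :
  array3_app (conv_array R G) f x = \sum_y f y * f (x - y).
Proof.
apply: eq_bigr => y _; rewrite (bigD1 (x - y)) //= big1 => [|z ne_z].
  by rewrite addr0 /conv_array addrC subrK eqxx mul1r.
rewrite /conv_array ifN ?mul0r //; apply: contraNneq ne_z => ->.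
by rewrite addrC addKr.
Qed.

Lemma sum_prod_row (R : realType) (T : finType) (n : nat)
    (F : 'I_n -> T -> R[i]) :
  \sum_(y : 'rV[T]_n) \prod_j F j (y 0 j) = \prod_j \sum_t F j t.
Proof.
rewrite bigA_distr_bigA /=.
rewrite (reindex (fun f : {ffun 'I_n -> T} => \row_j f j)) /=.
  by apply: eq_bigr => f _; apply: eq_bigr => j _; rewrite mxE.
exists (fun y : 'rV[T]_n => [ffun j => y 0 j]) => [f _ | y _].
  by apply/ffunP=> j; rewrite ffunE mxE.
by apply/rowP=> j; rewrite mxE ffunE.
Qed.

(** Both the convolution of a tensor product with itself and its pointwise
    square are products over the coordinates, so the eigenvalue equations of
    the factors multiply to the one of the product. *)
Lemma eigenvalue3_prod (R : realType) (G : finZmodType) (s : seq R[i]) :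
    {in s, forall t, eigenvalue3 (conv_array R G) t} ->
  eigenvalue3 (conv_array R 'rV[G]_(size s)) (\prod_(t <- s) t).
Proof.
move=> eig_s.
have /fin_all_exists[h eig_h] : forall j : 'I_(size s), exists f : G -> R[i],
    (exists x, f x != 0) /\
    (forall x, array3_app (conv_array R G) f x = s`_j * f x ^+ 2).
  by move=> j; apply: eig_s; apply: mem_nth.
have /fin_all_exists[a a_nz] : forall j, exists x, h j x != 0.
  by move=> j; case: (eig_h j).
exists (fun x : 'rV[G]_(size s) => \prod_j h j (x 0 j)); split.
  exists (\row_j a j); rewrite prodf_seq_neq0; apply/allP=> j _.
  by rewrite mxE a_nz.
move=> x; rewrite (big_nth 0) big_mkord conv_array_app -prodrXl -big_split /=.
rewrite (eq_bigr (fun y : 'rV[G]_(size s) =>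
  \prod_j (h j (y 0 j) * h j (x 0 j - y 0 j)))).
  rewrite (sum_prod_row R G _ (fun j t => h j t * h j (x 0 j - t))).
  by apply: eq_bigr => j _; rewrite -conv_array_app; case: (eig_h j).
by move=> y _; rewrite -big_split; apply: eq_bigr => j _; rewrite !mxE.
Qed.

(** The nonzero elements of [F_3] are [1] and [-1], and [x = y + z] with
    [x != 0] forces [{y, z} = {0, x}] or [y = z = - x]. *)
Lemma eigenvalue3_F3 (R : realType) (b : R[i]) :
  b ^+ 4 = b -> eigenvalue3 (conv_array R 'F_3) (1 + 2 * b ^+ 2).
Proof.
move=> b4; exists (fun x => if x == 0 then 1 else b); split.
  by exists 0; rewrite eqxx oner_neq0.
have eig1 : 2 * b + b ^+ 2 = (1 + 2 * b ^+ 2) * b ^+ 2.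
  by rewrite -{1}b4; ring.
move=> x; rewrite conv_array_app !big_ord_recl big_ord0.
case: x => [[|[|[|//]]] lt_x] /=; rewrite -?eig1; ring.
Qed.

Lemma eigenvalue3_F3_sqrtN3 (R : realType) (s : R[i]) :
  s ^+ 2 = - 3 -> eigenvalue3 (conv_array R 'F_3) s.
Proof.
move=> s2.
(* [1 + 2 w ^ 2 = s] forces [w ^ 2 = (s - 1) / 2], and then [w ^ 4 = w] forces
   [w] to be the square of that number, which is [- (1 + s) / 2]. *)
pose w : R[i] := - (1 + s) / 2.
have w2 : w ^+ 2 = (s - 1) / 2.
  rewrite (_ : w ^+ 2 = (1 + 2 * s + s ^+ 2) / 4); last by rewrite /w; field.
  by rewrite s2; field.
rewrite (_ : s = 1 + 2 * w ^+ 2); last by rewrite w2; field.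
apply: eigenvalue3_F3; rewrite (exprM w 2 2) w2.
rewrite (_ : ((s - 1) / 2) ^+ 2 = (s ^+ 2 - 2 * s + 1) / 4); last by field.
by rewrite s2 /w; field.
Qed.

Lemma sqr_i_sqrt3 (R : realType) : ('i%C * (Num.sqrt 3)%:C%C) ^+ 2 = - 3 :> R[i].
Proof.
by rewrite exprMn sqr_i -rmorphXn /= sqr_sqrtr ?ler0n // rmorph_nat mulN1r.
Qed.

Theorem theorem3 (R : realType) (n : nat) (hn : (1 <= n)%N)
    (k0 k1 k2 : nat) (hk : (k0 + k1 + k2 <= n)%N) :
  eigenvalue3 (conv_array R 'rV['F_3]_n)
    (3 ^+ k0 * ('i%C * (Num.sqrt 3)%:C%C) ^+ k1 * (- 'i%C * (Num.sqrt 3)%:C%C) ^+ k2).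
Proof.
set u := 'i%C * _; set v := - 'i%C * _.
(* One eigenvalue of the factor [F_3] for each of the [n] coordinates. *)
pose s := nseq k0 3 ++ nseq k1 u ++ nseq k2 v ++ nseq (n - (k0 + k1 + k2)) 1.
have size_s : size s = n.
  by rewrite !size_cat !size_nseq !addnA subnKC.
have prod_s : \prod_(t <- s) t = 3 ^+ k0 * u ^+ k1 * v ^+ k2.
  by rewrite !big_cat /= !big_nseq !iter_mulr_1 expr1n mulr1 mulrA.
have := eigenvalue3_prod R 'F_3 s; rewrite size_s prod_s; apply=> t.
rewrite !mem_cat !mem_nseq.
case/or4P=> /andP[_ /eqP->].
- rewrite (_ : 3 = 1 + 2 * 1 ^+ 2); last by ring.
  by apply: eigenvalue3_F3; rewrite expr1n.
- exact/eigenvalue3_F3_sqrtN3/sqr_i_sqrt3.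
- by apply: eigenvalue3_F3_sqrtN3; rewrite /v mulNr sqrrN sqr_i_sqrt3.
- rewrite (_ : 1 = 1 + 2 * 0 ^+ 2); last by ring.
  by apply: eigenvalue3_F3; rewrite expr0n.
Qed.
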